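(* Let $P$ be a pregroup, $\Gamma=P\setminus\{\varepsilon\}$, $S=S(P)$. Cyclically reduced elements are minimal length representatives of their conjugacy class in $U(P)$. Let $g$ and $f$ be cyclically reduced elements of $\Gamma^*$ such that $g$ is conjugate to $f$ in $U(P)$. Then the following hold. 1. $g$ and $f$ have the same length. 2. If $g\notin P$, i.e. $|g|\ge2$, then we can transform the cyclic word $g_\sim$ into the cyclic word $f_\sim$ by a sequence of at most $|g|$ length preserving rules from $C^\dagger(S)$. 3. If $g\in P$, i.e. $|g|=1$, then we can transform $g$ into $f$ by a sequence of preconjugations.
   Context: A pregroup is a set $P$ with a distinguished element $\varepsilon$, a partial multiplication $(a,b)\mapsto ab$ defined for $(a,b)\in D\subseteq P\times P$, and an involution $a\mapsto\overline a$, such that for all $a,b,c,d\in P$: (P1) $a\varepsilon,\varepsilon a$ are defined and equal $a$; (P2) $\overline a a$, $a\overline a$ are defined and equal $\varepsilon$; (P3) if $ab$ is defined then so is $\overline b\,\overline a$, and $\overline{ab}=\overline b\,\overline a$; (P4) if $ab$ and $bc$ are defined, then $(ab)c$ is defined iff $a(bc)$ is defined, in which case they are equal; (P5) if $ab,bc,cd$ are defined then $abc$ or $bcd$ is defined. Write $[ab]\in P$ for the product when $(a,b)\in D$, to distinguish it from the word $ab$ of length 2. For $a,b,c\in P$, $abc\in P$ means that $[ab]c$ or $a[bc]$ is defined (including the inner product), and then $[abc]$ is the resulting product. $S(P)\subseteq\Gamma^*\times\Gamma^*$ consists of the rules $ab\to1$ (the empty word) if $(a,b)\in D$ and $[ab]=\varepsilon$;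 $ab\to[ab]$ if $(a,b)\in D$ and $[ab]\ne\varepsilon$; $ab\leftrightarrow[ac][\overline c b]$ if $(a,c),(\overline c,b)\in D$ and $(a,b)\notin D$. The universal group is $U(P)=\Gamma^*/S(P)$. Cyclic words: $u\sim v$ means $u=rs$, $v=sr$ for some words $r,s$; $w_\sim$ denotes the class of $w$. $u_\sim\overset{\circ}{\Longrightarrow}_S v_\sim$ iff some $u'\sim u$ rewrites in one step by $S$ to some $v'\sim v$. $C^\dagger(S)$ is the relation on cyclic words over $\Gamma$ obtained from $\overset{\circ}{\Longrightarrow}_{S}$ by adding $(u_\sim,v_\sim)$ and $(v_\sim,u_\sim)$ for all $u,v$ such that $u_\sim\overset{\circ}{\Longleftarrow}_{S}w_\sim\overset{\circ}{\Longrightarrow}_{S}v_\sim$ for some $w$ with $|w|\le2$ and $|w|>|u|\ge|v|\ge1$. A cyclically reduced word is a cyclic word $w_\sim$, $w\in\Gamma^*$, which is geodesic with respect to $C^\dagger(S)$, where a cyclic word $w_\sim$ is geodesic if $|w|$ is minimal among the lengths of all words in $\Gamma^*$ representing elements of $U(P)$ conjugate to $w$. An element $w\in\Gamma^*$ is cyclically reduced if $w_\sim$ is. All elements of $\Gamma$ are cyclically reduced. For $u\in\Gamma$, a preconjugation of $u$ by $c\in P$ is the element $[cu\overline c]$ in case $cu\overline c\in P$. *)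

(* Defs.v *)
From mathcomp Require Import all_boot.
From Stdlib Require Import Relations.

Set Implicit Arguments.
Unset Strict Implicit.
Unset Printing Implicit Defensive.

(* The partial product is option-valued: (a, b) \in D with [ab] = c is
   [pmul a b = Some c], and (a, b) \notin D is [pmul a b = None].  In [pmul_assoc]
   the equality of options says both that one side is defined iff the other is,
   and that the values then agree. *)
Record pregroup := Pregroup {
  pcarrier :> Type;
  pone : pcarrier;
  pmul : pcarrier -> pcarrier -> option pcarrier;
  pinv : pcarrier -> pcarrier;
  pinvK : forall a, pinv (pinv a) = a;
  pmul1 : forall a, pmul a pone = Some a /\ pmul pone a = Some a;
  pmulV : forall a, pmul (pinv a) a = Some pone /\ pmul a (pinv a) = Some pone;
  pmul_inv : forall a b c,
    pmul a b = Some c -> pmul (pinv b) (pinv a) = Some (pinv c);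
  pmul_assoc : forall a b c x y,
    pmul a b = Some x -> pmul b c = Some y -> pmul x c = pmul a y;
  pmul_four : forall a b c d x y z,
    pmul a b = Some x -> pmul b c = Some y -> pmul c d = Some z ->
    (exists t, pmul x c = Some t \/ pmul a y = Some t) \/
    (exists t, pmul y d = Some t \/ pmul b z = Some t)
}.

Arguments pone {_}.
Arguments pmul {_}.
Arguments pinv {_}.

(* abc \in P with [abc] = d *)
Definition pmul3 (P : pregroup) (a b c d : P) : Prop :=
  (exists2 x, pmul a b = Some x & pmul x c = Some d) \/
  (exists2 y, pmul b c = Some y & pmul a y = Some d).

Section CyclicRewriting.
Variable A : Type.
Implicit Types (u v w : seq A) (R C : relation (seq A)).

Definition rewrite_step R u v : Prop :=
  exists p q l r, [/\ R l r, u = p ++ l ++ q & v = p ++ r ++ q].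

Definition thue R : relation (seq A) :=
  clos_refl_sym_trans (seq A) (rewrite_step R).

(* u_~ = v_~.  A relation on cyclic words is represented below by the
   relation it induces on their representatives, which is invariant under
   [cyc_eq] on both sides. *)
Definition cyc_eq u v : Prop := exists r s, u = r ++ s /\ v = s ++ r.

Definition cyc_step R u v : Prop :=
  exists u' v', [/\ cyc_eq u' u, rewrite_step R u' v' & cyc_eq v' v].

Definition cyc_dagger R u v : Prop :=
  cyc_step R u v \/
  exists w, [/\ cyc_step R w u, cyc_step R w v, size w <= 2 &
    size v <= size u < size w /\ 1 <= size v \/
    size u <= size v < size w /\ 1 <= size u].

Definition length_preserving C u v : Prop := C u v /\ size u = size v.

(* u_~ is transformed into v_~ in exactly n steps of C *)
Fixpoint cyc_steps C n u v : Prop :=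
  if n is m.+1 then exists2 w, C u w & cyc_steps C m w v else cyc_eq u v.

Lemma cyc_eq_rot u v : cyc_eq u v <-> exists n, v = rot n u.
Proof.
split=> [[r [s [-> ->]]]|[n ->]]; first by exists (size r); rewrite rot_size_cat.
by exists (take n u), (drop n u); rewrite cat_take_drop.
Qed.

Lemma cyc_eq_refl u : cyc_eq u u.
Proof. by exists [::], u; rewrite cats0. Qed.

Lemma cyc_eq_sym u v : cyc_eq u v -> cyc_eq v u.
Proof. by case=> r [s [-> ->]]; exists s, r. Qed.

Lemma cyc_eq_trans u v w : cyc_eq u v -> cyc_eq v w -> cyc_eq u w.
Proof.
move=> /cyc_eq_rot[n ->] /cyc_eq_rot[m ->]; apply/cyc_eq_rot.
by rewrite rot_rot_add; eexists.
Qed.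

Lemma cyc_eq_size u v : cyc_eq u v -> size u = size v.
Proof. by case=> r [s [-> ->]]; rewrite !size_cat addnC. Qed.

Lemma cyc_step_compat R u1 u2 v1 v2 :
  cyc_eq u1 u2 -> cyc_eq v1 v2 -> cyc_step R u1 v1 -> cyc_step R u2 v2.
Proof.
move=> eu ev [u' [v' [eu' uv' ev']]]; exists u', v'; split=> //.
- exact: cyc_eq_trans eu' eu.
- exact: cyc_eq_trans ev' ev.
Qed.

Lemma cyc_dagger_compat R u1 u2 v1 v2 :
  cyc_eq u1 u2 -> cyc_eq v1 v2 -> cyc_dagger R u1 v1 -> cyc_dagger R u2 v2.
Proof.
move=> eu ev [uv|[w [wu wv w2 sz]]].
  by left; apply: cyc_step_compat uv.
right; exists w; rewrite -(cyc_eq_size eu) -(cyc_eq_size ev); split=> //.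
- exact: cyc_step_compat (cyc_eq_refl w) eu wu.
- exact: cyc_step_compat (cyc_eq_refl w) ev wv.
Qed.

End CyclicRewriting.

Section UniversalGroup.
Variable P : pregroup.

Definition letter : Type := {a : P | a <> pone}.
Definition lval (a : letter) : P := proj1_sig a.

(* In [pg_swap] and [pg_swap_sym], [ac] and [\bar c b] are automatically
   different from the identity, so taking them in [letter] is no restriction. *)
Inductive pg_rule : relation (seq letter) :=
| pg_cancel (a b : letter) :
    pmul (lval a) (lval b) = Some pone -> pg_rule [:: a; b] [::]
| pg_contract (a b x : letter) :
    pmul (lval a) (lval b) = Some (lval x) -> pg_rule [:: a; b] [:: x]
| pg_swap (a b x y : letter) (c : P) :
    pmul (lval a) c = Some (lval x) ->
    pmul (pinv c) (lval b) = Some (lval y) ->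
    pmul (lval a) (lval b) = None -> pg_rule [:: a; b] [:: x; y]
| pg_swap_sym (a b x y : letter) (c : P) :
    pmul (lval a) c = Some (lval x) ->
    pmul (pinv c) (lval b) = Some (lval y) ->
    pmul (lval a) (lval b) = None -> pg_rule [:: x; y] [:: a; b].

(* U(P) is the quotient of the free monoid by [univ_eq]. *)
Definition univ_eq : relation (seq letter) := thue pg_rule.

(* y^-1 * u * y = v in U(P), where x represents the inverse of y *)
Definition univ_conj (u v : seq letter) : Prop :=
  exists x y, [/\ univ_eq (x ++ y) [::], univ_eq (y ++ x) [::] &
                  univ_eq (x ++ u ++ y) v].

Definition cyclically_reduced (w : seq letter) : Prop :=
  forall v, univ_conj w v -> size w <= size v.

Definition preconj (u v : letter) : Prop :=
  exists c : P, pmul3 c (lval u) (pinv c) (lval v).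

Definition preconj_seq : relation letter := clos_refl_trans letter preconj.

End UniversalGroup.

(* Main.v *)
Require Import Defs.
From mathcomp Require Import all_boot.
From Stdlib Require Import Relations Classical ClassicalEpsilon Setoid Morphisms.

Set Implicit Arguments.
Unset Strict Implicit.
Unset Printing Implicit Defensive.

(** All computations take place with words over [P] itself, where [pone] is an
    admissible letter and the only length-reducing rule is the contraction
    [a b -> [ab]].  Two words [u], [v] name the same element of U(P) when
    [pone :: u] and [pone :: v] are connected by contractions; the leading
    [pone] absorbs cancelled pairs, so that no rule producing the empty word
    has to be considered ([univ_eq_geq], [geq_univ_eq]).

    The word problem rests on one confluence argument.  Contractions of the
    same word lead to words that are equal, have a common contraction, or
    differ by a swap [a b <-> [ac][c^-1 b]] ([contr_contr]), and a swap does not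
    destroy the possibility of a contraction ([swap_contr]; this is where
    axiom (P5) enters).  Since contractions shorten words, reduced words that
    represent the same element are connected by swaps ([ceq_nf]).  A sequence
    of swaps of any length can be replaced by one left-to-right sweep, in which
    each pair of neighbours is swapped once ([sweep_swap]); so two reduced words
    of length n for the same element are at most n-1 swaps apart.

    Conjugacy is handled by induction on the length of the conjugating word p.
    Let g have minimal length n >= 2 in its conjugacy class, let f have length n
    and let p^-1 g p = f.  If neither p_1^-1 g_1 nor g_n p_1 is defined, then
    p^-1 g p is a reduced word longer than f, unless p is empty.  Otherwise g is
    rotated, which multiplies p on the left by g_1^-1 or g_n; after at most one
    rotation either p can be shortened, or both products are defined, and then
    p has length 1 or can be shortened by a further rotation ([conj_left],
    [conj_both]).  Thus some rotation a m b of g and some c in P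
    satisfy f = [c^-1 a] m [b c] in U(P) ([conj_uptoP]).  On cyclic words,
    passing from g to [c^-1 a] m [b c] is one swap of the neighbours b and a,
    and a sweep of at most n-1 swaps leads on to f: at most n steps in total
    ([one_conj_pg_steps]).

    For a single letter the same induction applies to p^-1 a p, with a
    preconjugation whenever p_1^-1 a p_1 lies in P ([preconj_seq_conj]). *)

Section Pregroup.
Variable P : pregroup.
Implicit Types (a b c d e x y z s t : P) (p q u v w : seq P).

(** * Partial products *)

Lemma pinv1 : pinv pone = pone :> P.
Proof.
have [_ E] := pmulV (@pone P); have [_ F] := pmul1 (pinv (@pone P)).
by move: E; rewrite F => -[].
Qed.

Lemma pmulKl a b c : pmul a b = Some c -> pmul (pinv a) c = Some b.
Proof.
move=> abc; have [aV _] := pmulV a.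
by rewrite -(pmul_assoc aV abc); case: (pmul1 b).
Qed.

Lemma pmulKr a b c : pmul a b = Some c -> pmul c (pinv b) = Some a.
Proof.
move=> abc; have [_ bV] := pmulV b.
by rewrite (pmul_assoc abc bV); case: (pmul1 a).
Qed.

Lemma pmulVKl a b c : pmul (pinv a) b = Some c -> pmul a c = Some b.
Proof. by move/pmulKl; rewrite pinvK. Qed.

Lemma pmulVKr a b c : pmul a (pinv b) = Some c -> pmul c b = Some a.
Proof. by move/pmulKr; rewrite pinvK. Qed.

Lemma pmul_invE a b : isSome (pmul (pinv b) (pinv a)) = isSome (pmul a b).
Proof.
case E: (pmul a b) => [c|]; first by rewrite (pmul_inv E).
by case F: pmul => [c|//]; move/pmul_inv: F; rewrite !pinvK E.
Qed.

(** Axiom (P5) is used in the following two forms, in which one of its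
    alternatives is excluded and the other yields both bracketings. *)
Lemma pmul_fourl a b c d x y z :
  pmul a b = Some x -> pmul b c = Some y -> pmul c d = Some z ->
  pmul y d = None -> exists2 t, pmul a y = Some t & pmul x c = Some t.
Proof.
move=> ab bc cd yd; have xy := pmul_assoc ab bc; have yz := pmul_assoc bc cd.
have [[t]|[t]] := pmul_four ab bc cd; last by rewrite -yz yd; case.
by rewrite -xy; case=> xc; exists t.
Qed.

Lemma pmul_fourr a b c d x y z :
  pmul a b = Some x -> pmul b c = Some y -> pmul c d = Some z ->
  pmul x c = None -> exists2 t, pmul y d = Some t & pmul b z = Some t.
Proof.
move=> ab bc cd xc; have xy := pmul_assoc ab bc; have yz := pmul_assoc bc cd.
have [[t]|[t]] := pmul_four ab bc cd; first by rewrite -xy xc; case.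
by rewrite -yz; case=> yd; exists t.
Qed.

(** The two sides of a swap have the same product, if any, by (P4). *)
Lemma pmul_swap a b c x y :
  pmul a c = Some x -> pmul (pinv c) b = Some y -> pmul x y = pmul a b.
Proof. by move=> /pmulKr ac cb; rewrite (pmul_assoc ac cb). Qed.

(** * Contractions and swaps *)

(** Both rules are given by recursion on the position where they apply, so that
    inversion enumerates the critical pairs. *)
Inductive contr : relation (seq P) :=
| contr_head a b c q : pmul a b = Some c -> contr (a :: b :: q) (c :: q)
| contr_cons a u v : contr u v -> contr (a :: u) (a :: v).

Inductive swap : relation (seq P) :=
| swap_head a b c x y q :
    pmul a c = Some x -> pmul (pinv c) b = Some y -> pmul a b = None ->
    swap (a :: b :: q) (x :: y :: q)
| swap_cons a u v : swap u v -> swap (a :: u) (a :: v).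

Lemma contr_size u v : contr u v -> size u = (size v).+1.
Proof. by elim=> //= a {}u {}v _ ->. Qed.

Lemma swap_size u v : swap u v -> size u = size v.
Proof. by elim=> //= a {}u {}v _ ->. Qed.

Lemma swap_sym u v : swap u v -> swap v u.
Proof.
elim=> [a b c x y q ac cb ab|a {}u {}v _]; last exact: swap_cons.
apply: (@swap_head x y (pinv c)); first exact: pmulKr.
  by rewrite pinvK; apply: pmulVKl.
by rewrite (pmul_swap ac cb).
Qed.

(** The relation between two contractions of a word, or of two words that differ
    by a swap; it suffices for normal forms to agree up to swaps. *)
Definition near u v : Prop :=
  [\/ u = v, swap u v | exists2 w, contr u w & contr v w].

Lemma near_cons a u v : near u v -> near (a :: u) (a :: v).
Proof.
case=> [->|uv|[w uw vw]]; first by constructor 1.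
  by constructor 2; constructor.
by constructor 3; exists (a :: w); constructor.
Qed.

Lemma near_swap a b c x y q :
  pmul a c = Some x -> pmul (pinv c) b = Some y ->
  near (a :: b :: q) (x :: y :: q).
Proof.
move=> ac cb; case ab: (pmul a b) => [s|]; last first.
  by constructor 2; apply: swap_head cb ab.
constructor 3; exists (s :: q); constructor => //.
by rewrite (pmul_swap ac cb).
Qed.

(** The only overlap is a b d with ab and bd defined.  Its contractions [ab] d and
    a [bd] differ by the swap along b^-1, or contract to the same word by (P4). *)
Lemma contr_contr w u v : contr w u -> contr w v -> near u v.
Proof.
move=> wu; elim: wu v => [a b c q ab|a {}w {}u wu IH] v wv.
  inversion wv as [a' b' c' q' ab'|a' u' v' bq]; subst.
    by move: ab'; rewrite ab => -[->]; constructor 1.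
  inversion bq as [b'' d e q'' bd|b'' u'' v'' qv]; subst.
    by apply: (@near_swap _ _ (pinv b)); [exact: pmulKr | rewrite pinvK].
  by constructor 3; exists (c :: v''); constructor.
inversion wv as [a' b' c' q' ab'|a' u' v' wv']; subst; last first.
  exact/near_cons/IH.
inversion wu as [b'' d e q'' bd|b'' u'' v'' qv]; subst.
  by apply: (@near_swap _ _ b' ) => //; apply: pmulKl.
by constructor 3; exists (c' :: v''); constructor.
Qed.

(** A pair with undefined product stays so under a swap, so a contraction can only
    overlap a swap in one letter.  For the swap of a b along c and bd defined,
    (P5) for [ac], c^-1, b, d shows that [c^-1 b] d is defined, because ab is not;
    the other overlap is symmetric. *)
Lemma swap_contr w w' u :
  swap w w' -> contr w u -> exists2 u', contr w' u' & near u u'.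
Proof.
move=> ww'; elim: ww' u => [a b c x y q ac cb ab|a {}w {}w' ww' IH] u wu.
  inversion wu as [a' b' c' q' ab'|a' u' v' bq]; subst.
    by rewrite ab in ab'.
  inversion bq as [b'' d e q'' bd|b'' u'' v'' qv]; subst.
    have [t yd ce] := pmul_fourr (pmulKr ac) cb bd ab.
    by exists (x :: t :: q''); [do 2 constructor | apply: near_swap ce].
  by exists (x :: y :: v''); [do 2 constructor|constructor 2; apply: swap_head cb ab].
inversion wu as [a' b' s q' ab'|a' u' v' wv']; subst; last first.
  have [u' wu' nu] := IH _ wv'.
  by exists (a :: u'); [constructor|apply: near_cons].
inversion ww' as [b d c x y q bc cd bd|b'' u'' v'' qv]; subst.
  have xy : pmul x y = None by rewrite (pmul_swap bc cd).
  have [t ax sc] := pmul_fourl ab' bc (pmulVKl cd) xy.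
  by exists (t :: y :: q); [constructor | apply: near_swap cd].
by exists (s :: v''); [constructor|constructor 2; constructor].
Qed.

(** * Uniqueness of reduced words up to swaps *)

Definition undef a b : bool := ~~ isSome (pmul a b).
Definition reduced w : bool := sorted undef w.

Lemma reduced_contr u v : reduced u -> ~ contr u v.
Proof.
move=> ru uv; elim: uv ru => [a b c q ab|a {}u {}v _ IH].
  by rewrite /reduced /= /undef ab.
by move/path_sorted.
Qed.

Lemma contr_or_reduced u : reduced u \/ exists v, contr u v.
Proof.
elim: u => [|a [|b u] IH]; [by left|by left|].
case: IH => [ru|[v uv]]; last by right; exists (a :: v); constructor.
case ab: (pmul a b) => [c|]; first by right; exists (c :: u); constructor.
by left; rewrite /reduced /= /undef ab.
Qed.

Lemma swap_reduced u v : swap u v -> reduced u -> reduced v.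
Proof.
move=> uv ru; have [//|[t vt]] := contr_or_reduced v.
by have [t' /(reduced_contr ru)] := swap_contr (swap_sym uv) vt.
Qed.

Definition swaps : relation (seq P) := clos_refl_trans_1n _ swap.

Lemma swaps_trans u v w : swaps u v -> swaps v w -> swaps u w.
Proof.
by elim=> [//|x y z xy _ IH] zw; apply: Relation_Operators.rt1n_trans xy (IH zw).
Qed.

Lemma swaps_sym u v : swaps u v -> swaps v u.
Proof.
elim=> [x|x y z xy _ zy]; first exact: Relation_Operators.rt1n_refl.
apply: swaps_trans zy _.
apply: Relation_Operators.rt1n_trans (swap_sym xy) _.
exact: Relation_Operators.rt1n_refl.
Qed.

Inductive nf : relation (seq P) :=
| nf_reduced u : reduced u -> nf u u
| nf_contr u v w : contr u v -> nf v w -> nf u w.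

Lemma nfP u : exists v, nf u v.
Proof.
have [n] := ubnP (size u); elim: n u => // n IH u un.
have [ru|[v uv]] := contr_or_reduced u; first by exists u; constructor.
have [|w vw] := IH v; first by rewrite (contr_size uv) in un.
by exists w; apply: nf_contr vw.
Qed.

Lemma nf_size u v : nf u v -> size v <= size u.
Proof. by elim=> // w w' w'' /contr_size-> _; apply: leqW. Qed.

(** Church-Rosser modulo swaps, by induction on the length.  A word at hand is
    either reduced, and then so are its swaps, or [contr_contr] and [swap_contr]
    transfer the claim to shorter words. *)
Lemma nf_unique_near_aux n :
  forall u v p q, size u < n -> size v < n ->
    near u v -> nf u p -> nf v q -> swaps p q.
Proof.
elim: n => // n IH.
have same u v p q w : size w <= n -> contr w u -> contr w v -> nf u p -> nf v q ->
    swaps p q.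
  move=> wn wu wv up vq; apply: IH (contr_contr wu wv) up vq.
    by rewrite -(contr_size wu).
  by rewrite -(contr_size wv).
have refl u p q : size u <= n -> nf u p -> nf u q -> swaps p q.
  move=> un up; case: up un => {u p} [u ru|u v p uv vp] un uq.
    case: uq ru {un} => [? _ _|u' v w u'v _ /reduced_contr/(_ u'v)//].
    exact: Relation_Operators.rt1n_refl.
  case: uq uv un => [u' /reduced_contr ru /ru//|u' v' q' u'v' v'q uv un].
  exact: same un uv u'v' vp v'q.
move=> u v p q; rewrite !ltnS => un vn.
case=> [uv|uv|[w uw vw]] up vq.
- by move: up; rewrite uv => up; apply: refl vq.
- case: up uv un => [u' ru uv un|u' t p' u't tp uv un].
    have rv := swap_reduced uv ru.
    case: vq uv rv {vn} => [v' _ uv _|v' t q' vt _ _ /reduced_contr/(_ vt)//].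
    apply: Relation_Operators.rt1n_trans uv _.
    exact: Relation_Operators.rt1n_refl.
  have [t' vt' tt'] := swap_contr uv u't.
  have [r t'r] := nfP t'.
  apply: (@swaps_trans _ r).
    apply: IH tt' tp t'r; first by rewrite -(contr_size u't).
    by rewrite -(contr_size vt').
  by apply: (refl v) => //; apply: nf_contr vt' t'r.
- have [r wr] := nfP w.
  apply: (@swaps_trans _ r); first by apply: (refl u) => //; apply: nf_contr wr.
  by apply: (refl v) => //; apply: nf_contr wr.
Qed.

Lemma nf_unique u p q : nf u p -> nf u q -> swaps p q.
Proof.
by apply: (@nf_unique_near_aux (size u).+1) => //; constructor 1.
Qed.

Definition ceq : relation (seq P) := clos_refl_sym_trans _ contr.

Lemma ceq_nf u v p q : ceq u v -> nf u p -> nf v q -> swaps p q.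
Proof.
move=> uv; elim: uv p q => {u v} [u v uv|u|u v _ IH|u v w _ IHu _ IHv] p q up vq.
- by apply: nf_unique (nf_contr uv vq).
- exact: nf_unique up vq.
- exact/swaps_sym/IH.
- have [r vr] := nfP v; exact: swaps_trans (IHu _ _ up vr) (IHv _ _ vr vq).
Qed.

(** * Sweeps *)

(** A pass from left to right that swaps each pair of neighbours once, i.e. an
    interleaving u_i -> c_(i-1)^-1 u_i c_i with c_0 and c_n trivial, evaluated
    from the left.  Swaps along [pone] are allowed. *)
Inductive sweep : relation (seq P) :=
| sweep1 a : sweep [:: a] [:: a]
| sweepS a b c x y u v :
    pmul a c = Some x -> pmul (pinv c) b = Some y -> sweep (y :: u) v ->
    sweep (a :: b :: u) (x :: v).

Lemma sweep_refl a u : sweep (a :: u) (a :: u).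
Proof.
elim: u a => [|b u IH] a; first exact: sweep1.
apply: (@sweepS _ _ pone _ b) => //; first by case: (pmul1 a).
by rewrite pinv1; case: (pmul1 b).
Qed.

(** A further swap along d of the letters i and i+1 of the target is absorbed by
    replacing c_i by c_i d.  That c_i d and the new partial results are defined
    follows from (P5), because the letters i and i+1 of the target have no
    product. *)
Lemma sweep_swap u v w : sweep u v -> swap v w -> sweep u w.
Proof.
move=> uv; elim: uv w => [a|a b c x y {}u {}v ac cb yuv IH] w vw.
  by inversion vw as [|? ? ? n]; subst; inversion n.
inversion vw as [x0 v1 d x' v1' q xd dv xv|x0 v0 v' vv']; subst; last first.
  by apply: sweepS ac cb (IH _ vv').
have xv' : pmul x' v1' = None by rewrite (pmul_swap xd dv).
have [c' ax' cd] := pmul_fourl (pmulKl ac) xd (pmulVKl dv) xv'.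
have c'b : pmul (pinv c') b = pmul (pinv d) y.
  exact: pmul_assoc (pmul_inv cd) cb.
apply: (@sweepS _ _ c'); first exact: pmulVKl.
  (* the default is immaterial: the product is defined in both cases of yuv *)
  rewrite c'b; apply: (_ : _ = Some (odflt y (pmul (pinv d) y))).
  inversion yuv as [|? ? e ? y2 ? ? ye]; subst; first by rewrite dv.
  by have [t _ ->] := pmul_fourr (pmulKr xd) dv (pmulKr ye) xv.
inversion yuv as [|? b2 e ? y2 ? ? ye eb]; subst.
  by rewrite dv; apply: sweep1.
have [t v1'e dy] := pmul_fourr (pmulKr xd) dv (pmulKr ye) xv.
by rewrite dy /=; apply: sweepS eb _ => //; apply: pmulVKr.
Qed.

Lemma sweep_swaps u v w : sweep u v -> swaps v w -> sweep u w.
Proof.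
by move=> uv vw; elim: vw uv => // x y z xy _ IH ux; apply/IH/(sweep_swap ux).
Qed.

(** * The group of words *)

Lemma ceq_cons a u v : ceq u v -> ceq (a :: u) (a :: v).
Proof.
elim=> [x y xy|x|x y _ IH|x y z _ IHx _ IHz].
- exact/rst_step/contr_cons.
- exact: rst_refl.
- exact: rst_sym.
- exact: rst_trans IHx IHz.
Qed.

Lemma contr_catr u v w : contr u v -> contr (u ++ w) (v ++ w).
Proof.
by elim=> [a b c q ab|a {}u {}v _ IH]; constructor.
Qed.

Lemma ceq_catr u v w : ceq u v -> ceq (u ++ w) (v ++ w).
Proof.
elim=> [x y xy|x|x y _ IH|x y z _ IHx _ IHz].
- exact/rst_step/contr_catr.
- exact: rst_refl.
- exact: rst_sym.
- exact: rst_trans IHx IHz.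
Qed.

Lemma contr1l a u : contr (pone :: a :: u) (a :: u).
Proof. by constructor; case: (pmul1 a). Qed.

Lemma contr1r a u : contr (a :: pone :: u) (a :: u).
Proof. by constructor; case: (pmul1 a). Qed.

(** Equality in U(P).  [ceq] alone does not relate [::] to [:: pone]. *)
Definition geq : relation (seq P) := fun u v => ceq (pone :: u) (pone :: v).

Lemma geq_refl : reflexive _ geq. Proof. by move=> u; apply: rst_refl. Qed.
Lemma geq_sym : symmetric _ geq. Proof. by move=> u v; apply: rst_sym. Qed.
Lemma geq_trans : transitive _ geq.
Proof. by move=> u v w; apply: rst_trans. Qed.

#[local] Hint Resolve geq_refl : core.

Lemma ceq_geq u v : ceq u v -> geq u v.
Proof. exact: ceq_cons. Qed.

Lemma geq_ceq a u b v : geq (a :: u) (b :: v) -> ceq (a :: u) (b :: v).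
Proof.
move=> uv; apply: rst_trans (rst_step _ _ _ _ (contr1l b v)).
by apply: rst_trans uv; apply/rst_sym/rst_step/contr1l.
Qed.

Lemma geq_cons a u v : geq u v -> geq (a :: u) (a :: v).
Proof.
move=> uv; apply: ceq_geq; apply: rst_trans (rst_step _ _ _ _ (contr1r a v)).
apply: rst_trans (ceq_cons a uv); exact/rst_sym/rst_step/contr1r.
Qed.

Lemma geq_cat u u' v v' : geq u u' -> geq v v' -> geq (u ++ v) (u' ++ v').
Proof.
move=> uu' vv'; apply: (@geq_trans _ (u ++ v')); last exact: (ceq_catr v' uu').
by elim: u {uu'} => //= a u IH; apply: geq_cons.
Qed.

#[local] Instance geq_equiv : Equivalence geq.
Proof. by split; [apply: geq_refl|apply: geq_sym|apply: geq_trans]. Qed.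

#[local] Instance geq_cat_proper : Proper (geq ==> geq ==> geq) cat.
Proof. by move=> u u' uu' v v' vv'; apply: geq_cat. Qed.

#[local] Instance geq_cons_proper a : Proper (geq ==> geq) (cons a).
Proof. by move=> u u'; apply: geq_cons. Qed.

Lemma geq_one u : geq (pone :: u) u.
Proof. exact/rst_step/contr1l. Qed.

Lemma geq_mul a b c u : pmul a b = Some c -> geq (a :: b :: u) (c :: u).
Proof. by move=> ab; apply/ceq_geq/rst_step; constructor. Qed.

Lemma geq_reduced_sweep a u b v :
  reduced (a :: u) -> reduced (b :: v) -> geq (a :: u) (b :: v) ->
  sweep (a :: u) (b :: v).
Proof.
move=> ru rv /geq_ceq uv; apply: sweep_swaps (sweep_refl a u) _.
by apply: ceq_nf uv _ _; constructor.
Qed.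

Lemma swaps_size u v : swaps u v -> size u = size v.
Proof. by elim=> // x y z /swap_size->. Qed.

Lemma reduced_geodesic u v : 0 < size v -> reduced u -> geq u v -> size u <= size v.
Proof.
case: u => // a u; case: v => // b v _ ru /geq_ceq uv.
have [w vw] := nfP (b :: v).
by rewrite (swaps_size (ceq_nf uv (nf_reduced ru) vw)) nf_size.
Qed.

Definition inv w : seq P := rev [seq pinv a | a <- w].

Lemma inv_cons a w : inv (a :: w) = rcons (inv w) (pinv a).
Proof. by rewrite /inv /= rev_cons. Qed.

Lemma inv_rcons a w : inv (rcons w a) = pinv a :: inv w.
Proof. by rewrite /inv map_rcons rev_rcons. Qed.

Lemma inv_cat u v : inv (u ++ v) = inv v ++ inv u.
Proof. by rewrite /inv map_cat rev_cat. Qed.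

Lemma invK w : inv (inv w) = w.
Proof.
by rewrite /inv map_rev revK -map_comp -[RHS]map_id; apply: eq_map => a /=; apply: pinvK.
Qed.

Lemma size_inv w : size (inv w) = size w.
Proof. by rewrite size_rev size_map. Qed.

Lemma geq_catVK u w : geq (inv u ++ u ++ w) w.
Proof.
elim: u => //= a u IH; rewrite inv_cons cat_rcons.
have [aV _] := pmulV a; rewrite (geq_mul (u ++ w) aV) geq_one; exact: IH.
Qed.

Lemma geq_catKV u w : geq (u ++ inv u ++ w) w.
Proof. by have := geq_catVK (inv u) w; rewrite invK. Qed.

Lemma geq_catV u : geq (inv u ++ u) [::].
Proof. by have := geq_catVK u [::]; rewrite cats0. Qed.

Lemma geq_catrV u : geq (u ++ inv u) [::].
Proof. by have := geq_catV (inv u); rewrite invK. Qed.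

Lemma geq_inv u v : geq u v -> geq (inv u) (inv v).
Proof.
move=> uv; have uV : geq (u ++ inv v) [::] by rewrite uv geq_catrV.
by apply: geq_trans (geq_catVK u (inv v)); rewrite uV cats0.
Qed.

#[local] Instance geq_inv_proper : Proper (geq ==> geq) inv.
Proof. by move=> u v; apply: geq_inv. Qed.

(** * Conjugates of geodesic words *)

Definition conj p w : seq P := inv p ++ w ++ p.

#[local] Instance geq_conj_proper : Proper (geq ==> geq ==> geq) conj.
Proof. by move=> p p' E w w' F; rewrite /conj E F. Qed.

Lemma conj_cat u v w : conj (u ++ v) w = conj v (conj u w).
Proof. by rewrite /conj inv_cat -!catA. Qed.

Lemma geq_conjV p w v : geq (conj p w) v -> geq (conj (inv p) v) w.
Proof.
move=> <-; rewrite -conj_cat /conj inv_cat invK -!catA.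
by rewrite geq_catKV geq_catrV cats0.
Qed.

Lemma conj_inv p w : inv (conj p w) = conj p (inv w).
Proof. by rewrite /conj !inv_cat invK catA. Qed.

(** Rotating a word by [u] changes the conjugating word by [u^-1]. *)
Lemma geq_conj_rot p u v : geq (conj p (u ++ v)) (conj (inv u ++ p) (v ++ u)).
Proof. by rewrite /conj inv_cat invK -!catA geq_catKV. Qed.

(** Minimal length in the conjugacy class, among all words over [P]. *)
Definition geod w : Prop := forall p v, geq (conj p w) v -> size w <= size v.

Lemma undef_inv a b : undef (pinv b) (pinv a) = undef a b.
Proof. by rewrite /undef pmul_invE. Qed.

Lemma undefE a b : undef a b -> pmul a b = None.
Proof. by rewrite /undef; case: pmul. Qed.

Lemma undefI a b : pmul a b = None -> undef a b.
Proof. by rewrite /undef => ->. Qed.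

Lemma reduced_inv w : reduced (inv w) = reduced w.
Proof.
rewrite /reduced rev_sorted sorted_map; apply: eq_sorted => a b /=.
exact: undef_inv.
Qed.

Lemma reduced_cat_cons u a v :
  reduced (u ++ a :: v) = reduced (rcons u a) && reduced (a :: v).
Proof.
by case: u => [|b u] //; rewrite /reduced /= cat_path rcons_path andbA.
Qed.

(** The first letter of [w] can be contracted with the last letter of [inv p].
    Applied to [inv w] it expresses that the last letter of [w] can be
    contracted with the first letter of [p]. *)
Definition meets p w : bool :=
  match p, w with c :: _, a :: _ => isSome (pmul (pinv c) a) | _, _ => false end.

Lemma reduced_inv_cat p w :
  reduced p -> reduced w -> ~~ meets p w -> reduced (inv p ++ w).
Proof.
case: p => [//|c p]; case: w => [|a w] rp rw ca.
  by rewrite cats0 reduced_inv.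
rewrite inv_cons cat_rcons reduced_cat_cons -inv_cons reduced_inv rp.
by rewrite /reduced /= [undef _ _]ca.
Qed.

Lemma reduced_conj p w :
  0 < size w -> reduced p -> reduced w -> ~~ meets p w -> ~~ meets p (inv w) ->
  reduced (conj p w).
Proof.
move=> w0 rp rw pw pV; have rl := reduced_inv_cat rp rw pw.
have := reduced_inv_cat rp _ pV; rewrite !reduced_inv => /(_ rw).
rewrite -inv_cat reduced_inv; case: w w0 rl {rw pw pV} => // a w _.
by rewrite /conj /= !reduced_cat_cons => /andP[-> _].
Qed.

Lemma size_conj p w : size (conj p w) = size p + size w + size p.
Proof. by rewrite /conj !size_cat size_inv addnA. Qed.

(** When neither end of [w] is met by [p], the concatenation [p^-1 w p] is
    already reduced, hence no shorter word can represent the same element. *)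
Lemma conj_meets p w f :
  0 < size f < size p + size w + size p -> 0 < size w ->
  reduced p -> reduced w -> geq (conj p w) f -> meets p w || meets p (inv w).
Proof.
case/andP=> f0 fs w0 rp rw wf; apply: contraLR fs; rewrite negb_or -leqNgt.
case/andP=> pw pV; rewrite -size_conj.
by apply: reduced_geodesic wf => //; apply: reduced_conj.
Qed.

Lemma geod_inv w : geod w -> geod (inv w).
Proof.
move=> gw p v pv; rewrite size_inv -(size_inv v); apply: (gw p).
by rewrite -pv conj_inv invK.
Qed.

Lemma geod_conj p g h : geod g -> geq (conj p g) h -> size h = size g -> geod h.
Proof.
move=> gg gh hg q v hv; rewrite hg; apply: (gg (p ++ q)).
by rewrite conj_cat gh.
Qed.

Lemma conj0 w : conj [::] w = w.
Proof. by rewrite /conj /= cats0. Qed.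

Lemma geod_rot u v : geod (u ++ v) -> geod (v ++ u).
Proof.
move=> guv; apply: (geod_conj (p := u) guv); last by rewrite !size_cat addnC.
by rewrite /conj -!catA geq_catVK.
Qed.

Lemma geod_cyc g h : cyc_eq g h -> geod g -> geod h.
Proof. by case=> u [v [-> ->]]; apply: geod_rot. Qed.

Lemma geod_reduced w : geod w -> reduced w.
Proof.
move=> gw; have [//|[v wv]] := contr_or_reduced w.
have /gw : geq (conj [::] w) v by rewrite conj0; apply/ceq_geq/rst_step.
by rewrite (contr_size wv) ltnn.
Qed.

(** Both products with c are required to exist because, for the cyclic word, the
    conjugation is then a single swap of the neighbours b and a. *)
Definition one_conj g f : Prop :=
  exists c a m b x z, [/\ cyc_eq g (a :: rcons m b), pmul (pinv c) a = Some x,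
    pmul b c = Some z & geq (x :: rcons m z) f].

Lemma cyc_eq_inv g h : cyc_eq g h -> cyc_eq (inv g) (inv h).
Proof. by case=> u [v [-> ->]]; exists (inv v), (inv u); rewrite !inv_cat. Qed.

(** Inversion exchanges the two ends of a word and so reduces statements about the
    last letter to statements about the first. *)
Lemma one_conj_inv g f : one_conj (inv g) (inv f) -> one_conj g f.
Proof.
case=> c [a [m [b [x [z [gab ca bc xz]]]]]].
exists c, (pinv b), (inv m), (pinv a), (pinv z), (pinv x); split.
- by have := cyc_eq_inv gab; rewrite invK inv_cons inv_rcons.
- exact: pmul_inv.
- by have := pmul_inv ca; rewrite pinvK.
- by have := geq_inv xz; rewrite invK inv_cons inv_rcons.
Qed.

Lemma one_conj_cyc g h f : cyc_eq g h -> one_conj h f -> one_conj g f.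
Proof.
move=> gh [c [a [m [b [x [z [hab ca bc xz]]]]]]].
by exists c, a, m, b, x, z; split=> //; apply: cyc_eq_trans hab.
Qed.

Lemma cyc_eq_rcons (A : Type) (a : A) (w : seq A) : cyc_eq (a :: w) (rcons w a).
Proof. by exists [:: a], w; rewrite cats1. Qed.

(** The claim for conjugating words of length less than [n], which serves as the
    induction hypothesis. *)
Definition conj_upto n : Prop := forall p g f, size p < n -> geod g ->
  1 < size g -> size f = size g -> geq (conj p g) f -> one_conj g f.

(** If d^-1 c^-1 a is an element of P with inverse s', then rotating by a replaces
    the conjugating word c d p by a^-1 c d p = s' p, which is shorter. *)
Lemma conj_shorten n c d p a w f x s :
  conj_upto n -> (size p).+1 < n -> geod (a :: w) -> 0 < size w ->
  size f = (size w).+1 -> geq (conj [:: c, d & p] (a :: w)) f ->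
  pmul (pinv c) a = Some x -> pmul (pinv d) x = Some s -> one_conj (a :: w) f.
Proof.
move=> IH pn gg w0 fw gf ca dx; apply: one_conj_cyc (cyc_eq_rcons a w) _.
apply: (IH (pinv s :: p)).
- exact: pn.
- exact: geod_cyc (cyc_eq_rcons a w) gg.
- by rewrite size_rcons.
- by rewrite size_rcons.
rewrite -gf -cat1s (geq_conj_rot _ [:: a]) cats1 /=.
have ac : pmul (pinv a) c = Some (pinv x) by have := pmul_inv ca; rewrite pinvK.
have xd : pmul (pinv x) d = Some (pinv s) by have := pmul_inv dx; rewrite pinvK.
by rewrite /inv /= (geq_mul _ ac) (geq_mul _ xd).
Qed.

(** If c can be contracted with both ends of the geodesic word a m b, then
    [c^-1 a] m [b c] has the same length and is again geodesic, hence reduced.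
    The rest of the conjugating word is empty, or else its next letter must meet
    an end of this word, since f is too short otherwise; then
    [conj_shorten] applies, possibly to the inverse words. *)
Lemma conj_both n c p a m b x z f :
  conj_upto n -> size p < n -> geod (a :: rcons m b) -> reduced (c :: p) ->
  size f = (size m).+2 -> geq (conj (c :: p) (a :: rcons m b)) f ->
  pmul (pinv c) a = Some x -> pmul b c = Some z -> one_conj (a :: rcons m b) f.
Proof.
move=> IH pn gg rp fm gf ca bc.
have gh : geq (conj [:: c] (a :: rcons m b)) (x :: rcons m z).
  rewrite /conj /= (geq_mul _ ca) -!cats1 -catA /=.
  by rewrite (geq_mul _ bc).
case: p pn rp gf => [|d p] pn rp gf.
  exists c, a, m, b, x, z; split=> //; first exact: cyc_eq_refl.
  exact: geq_trans (geq_sym gh) gf.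
have rh : reduced (x :: rcons m z).
  by apply: geod_reduced; apply: geod_conj gg gh _; rewrite /= !size_rcons.
have hf : geq (conj (d :: p) (x :: rcons m z)) f by rewrite -gh -conj_cat.
have /orP[] : meets (d :: p) (x :: rcons m z) ||
    meets (d :: p) (inv (x :: rcons m z)).
- apply: conj_meets (path_sorted rp) rh hf => //.
  by rewrite fm /= size_rcons addnAC -[X in X < _]add0n ltn_add2r.
- rewrite /=; case dx: pmul => [s|//] _.
  by apply: (conj_shorten IH _ gg _ _ gf ca dx); rewrite ?size_rcons.
rewrite inv_cons inv_rcons /= pmul_invE; case zd: pmul => [s|//] _.
apply: one_conj_inv; rewrite inv_cons inv_rcons /=.
have gV : geq (conj [:: c, d & p] (pinv b :: rcons (inv m) (pinv a))) (inv f).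
  by rewrite -inv_cons -inv_rcons -conj_inv gf.
apply: (conj_shorten IH _ _ _ _ gV (pmul_inv bc) (pmul_inv zd)) => //.
- by rewrite -inv_cons -inv_rcons; apply: geod_inv.
- by rewrite size_rcons.
- by rewrite size_inv size_rcons size_inv.
Qed.

(** Let x = [c^-1 a], and suppose that bc is undefined for the last letter b.
    Unless the next letter of p meets x, the equality with f forces the
    conjugate to contract at x and the letter e after a.  Then after rotation by
    a the conjugating word starts with a^-1 c = x^-1, which can be contracted with
    both ends: x e is defined, and a x^-1 = c. *)
Lemma conj_left n c p a w f x :
  conj_upto n -> size p < n -> geod (a :: w) -> reduced (c :: p) -> 0 < size w ->
  size f = (size w).+1 -> geq (conj (c :: p) (a :: w)) f ->
  pmul (pinv c) a = Some x -> one_conj (a :: w) f.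
Proof.
move=> IH pn gg rp w0 fw gf ca.
have ac : pmul (pinv a) c = Some (pinv x) by have := pmul_inv ca; rewrite pinvK.
case/lastP: w w0 fw gg gf => [//|m b _ fw gg gf].
rewrite size_rcons in fw.
case bc: (pmul b c) => [z|].
  by apply: (conj_both IH pn gg rp _ gf ca bc); rewrite fw.
have bc' := undefI bc.
case Ew: (rcons m b) fw gg gf => [|e w'] fw gg gf; first by case: (m) Ew.
case px: (meets p [:: x]).
  case: p pn rp gf px => // d p pn rp gf /=.
  case dx: pmul => [s|//] _.
  apply: (conj_shorten IH _ gg _ _ gf ca dx) => //.
  by rewrite fw; move/(congr1 size): Ew; rewrite size_rcons => ->.
case xe: (pmul x e) => [t|].
  apply: one_conj_cyc (cyc_eq_rcons _ _) _.
  apply: (@conj_both n (pinv x) p e w' a t c) => //.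
  - exact: geod_cyc (cyc_eq_rcons _ _) gg.
  - case: (p) rp px => // d q; rewrite /reduced /= => /andP[_ ->] /negbT.
    by rewrite andbT -undef_inv pinvK.
  - by rewrite fw; move/(congr1 size): Ew; rewrite size_rcons => ->.
  - by rewrite -gf -[a :: _]cat1s (geq_conj_rot _ [:: a]) cats1 /inv /= (geq_mul _ ac).
  - by rewrite pinvK.
  - exact: pmulVKl.
(* Neither xe nor bc is defined: the word x e .. b c is reduced, and its
   conjugate by p is too long to represent f. *)
have gx : geq (conj [:: c] (a :: e :: w')) (x :: rcons (rcons m b) c).
  by rewrite Ew /conj /= (geq_mul _ ca) cats1.
have rx : reduced (x :: rcons (rcons m b) c).
  rewrite -cats1 cat_rcons -cat_cons reduced_cat_cons rcons_cons Ew.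
  rewrite /reduced /= (undefI xe) bc' andbT /=.
  move: (geod_reduced gg); rewrite /reduced /= => /andP[_ ->]; by rewrite ?andbT.
have xf : geq (conj p (x :: rcons (rcons m b) c)) f by rewrite -gx -conj_cat.
have /orP[] : meets p (x :: rcons (rcons m b) c) ||
    meets p (inv (x :: rcons (rcons m b) c)).
- apply: conj_meets (path_sorted rp) rx xf => //.
  by rewrite fw /= !size_rcons addnAC leq_addl.
- by case: (p) px => //= d q ->.
rewrite -rcons_cons inv_rcons; case: (p) rp => //= d q.
by rewrite pmul_invE /undef => /andP[/negPf->].
Qed.

Lemma conj_uptoP n : conj_upto n.
Proof.
elim: n => [//|n IH] p g f; rewrite ltnS => pn gg g1 fg gf.
have [rp|[q pq]] := contr_or_reduced p; last first.
  apply: (IH q) => //; first by rewrite -(contr_size pq).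
  by rewrite -gf -(ceq_geq (rst_step _ _ _ _ pq)).
case: p pn rp gf => [|c p] pn rp gf.
  case: g gg g1 fg gf => [//|a w] gg g1 fg; case/lastP: w gg g1 fg => [//|m b].
  move=> _ _ _; rewrite conj0 => gf; exists pone, a, m, b, a, b.
  have [b1 _] := pmul1 b; have [_ a1] := pmul1 a.
  by split=> //; [exact: cyc_eq_refl | rewrite pinv1].
have gV : geq (conj (c :: p) (inv g)) (inv f) by rewrite -conj_inv gf.
have /orP[pg|pV] : meets (c :: p) g || meets (c :: p) (inv g).
- apply: conj_meets rp (geod_reduced gg) gf; last exact: ltnW.
  by rewrite fg (ltnW g1) addnAC -[X in X < _]add0n ltn_add2r.
- case: g gg g1 fg gf pg {gV} => //= a w gg g1 fg gf.
  by case ca: pmul => [x|//] _; apply: (conj_left IH) gf ca.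
apply: one_conj_inv; have giV := geod_inv gg.
move: (size_inv g) giV gV pV; case: (inv g) => //= a w sg giV gV.
case ca: pmul => [x|//] _; apply: (conj_left IH) gV ca => //.
  by move: g1; rewrite -sg.
by rewrite size_inv fg.
Qed.

(** * Words over letters *)

Lemma lval_inj : injective (@lval P).
Proof.
move=> [a a1] [b b1] /= ab; subst b; congr exist; exact: proof_irrelevance.
Qed.

Fixpoint letters w : seq (letter P) :=
  if w is a :: w' then
    match excluded_middle_informative (a = pone) with
    | left _ => letters w'
    | right a1 => exist _ a a1 :: letters w'
    end
  else [::].

Notation vals := (map (@lval P)).

Lemma lettersK (u : seq (letter P)) : letters (vals u) = u.
Proof.
elim: u => //= -[a a1] u IH; case: excluded_middle_informative => //= b1.
by rewrite IH; congr cons; apply: lval_inj.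
Qed.

Lemma letters_size w : size (letters w) <= size w.
Proof.
by elim: w => //= a w IH; case: excluded_middle_informative => //= _; apply: leqW.
Qed.

Lemma letters_cat u v : letters (u ++ v) = letters u ++ letters v.
Proof.
by elim: u => //= a u ->; case: excluded_middle_informative.
Qed.

Lemma rewrite_step_ctx (A : Type) (R : relation (seq A)) (p q u v : seq A) :
  rewrite_step R u v -> rewrite_step R (p ++ u ++ q) (p ++ v ++ q).
Proof.
case=> p' [q' [l [r [lr -> ->]]]]; exists (p ++ p'), (q' ++ q), l, r.
by rewrite -!catA.
Qed.

Lemma univ_eq_cons (a : letter P) (u v : seq (letter P)) : univ_eq u v -> univ_eq (a :: u) (a :: v).
Proof.
elim=> [x y xy|x|x y _ IH|x y z _ IHx _ IHz].
- apply: rst_step; have := rewrite_step_ctx [:: a] [::] xy.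
  by rewrite !cats0.
- exact: rst_refl.
- exact: rst_sym.
- exact: rst_trans IHx IHz.
Qed.

Lemma rule_univ_eq (l r u : seq (letter P)) :
  pg_rule l r -> univ_eq (l ++ u) (r ++ u).
Proof. by move=> lr; apply: rst_step; exists [::], u, l, r. Qed.

Lemma letters1 w : letters (pone :: w) = letters w.
Proof. by rewrite /=; case: excluded_middle_informative. Qed.

Lemma letters_cons a (a1 : a <> pone) w :
  letters (a :: w) = exist _ a a1 :: letters w.
Proof.
rewrite /=; case: excluded_middle_informative => // b1.
by rewrite (proof_irrelevance _ a1 b1).
Qed.

Lemma contr_univ_eq u v : contr u v -> univ_eq (letters u) (letters v).
Proof.
elim=> [a b c q ab|a {}u {}v _ IH]; last first.
  have [->|a1] := classic (a = pone); first by rewrite !letters1.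
  by rewrite !letters_cons; apply: univ_eq_cons.
have [a1|a1] := classic (a = pone).
  subst a; have [_] := pmul1 b; rewrite ab => -[->].
  by rewrite letters1; apply: rst_refl.
rewrite letters_cons; have [b1|b1] := classic (b = pone).
  subst b; have [] := pmul1 a; rewrite ab => -[->] _.
  by rewrite letters1 letters_cons; apply: rst_refl.
rewrite letters_cons; have [c1|c1] := classic (c = pone).
  subst c; rewrite letters1.
  by apply: (rule_univ_eq (l := [:: _; _]) (r := [::])); apply: pg_cancel.
rewrite letters_cons.
by apply: (rule_univ_eq (l := [:: _; _]) (r := [:: _])); apply: pg_contract.
Qed.

Lemma geq_univ_eq u v : geq u v -> univ_eq (letters u) (letters v).
Proof.
rewrite -(letters1 u) -(letters1 v) /geq; elim=> [x y xy|x|x y _ IH|x y z _ IHx _ IHz].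
- exact: contr_univ_eq.
- exact: rst_refl.
- exact: rst_sym.
- exact: rst_trans IHx IHz.
Qed.

Lemma univ_eq_geq (u v : seq (letter P)) : univ_eq u v -> geq (vals u) (vals v).
Proof.
have swp a b c x y w : pmul a c = Some x -> pmul (pinv c) b = Some y ->
    geq (a :: b :: w) (x :: y :: w).
  move=> ac cb; rewrite -(geq_mul w cb); symmetry.
  by rewrite (geq_mul _ (pmulKr ac)).
elim=> [x y [p [q [l [r [lr -> ->]]]]]|x|x y _ IH|x y z _ IHx _ IHz].
- rewrite !map_cat; apply: geq_cat => //.
  case: lr => [a b ab|a b c ab|a b c d e ac cb _|a b c d e ac cb _] /=.
  + by rewrite (geq_mul _ ab) geq_one.
  + by rewrite (geq_mul _ ab).
  + exact: swp ac cb.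
  + symmetry; exact: swp ac cb.
- exact: rst_refl.
- exact: rst_sym.
- exact: rst_trans IHx IHz.
Qed.

Lemma univ_conj_conj (g f : seq (letter P)) :
  univ_conj g f -> exists p, geq (conj p (vals g)) (vals f).
Proof.
case=> x [y [xy yx gf]]; exists (vals y).
have := univ_eq_geq gf; rewrite !map_cat => <-.
have := univ_eq_geq xy; rewrite map_cat /= => xy1.
have E : geq (inv (vals y)) (vals x).
  have : geq (vals x ++ vals y ++ inv (vals y)) (vals x).
    by rewrite geq_catrV cats0.
  by rewrite catA xy1.
by rewrite /conj E.
Qed.

Lemma conj_univ_conj (g : seq (letter P)) p v :
  geq (conj p (vals g)) v -> univ_conj g (letters v).
Proof.
move=> gv; exists (letters (inv p)), (letters p); split.
- by rewrite -letters_cat; apply: (geq_univ_eq (geq_catV p)).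
- by rewrite -letters_cat; apply: (geq_univ_eq (geq_catrV p)).
- have := geq_univ_eq gv.
  by rewrite /conj !letters_cat lettersK.
Qed.

Lemma cyclically_reduced_geod (g : seq (letter P)) :
  cyclically_reduced g -> geod (vals g).
Proof.
move=> gg p v /conj_univ_conj/gg; rewrite size_map => le.
exact: leq_trans le (letters_size v).
Qed.

Lemma undef_neq1 a b : undef a b -> a <> pone /\ b <> pone.
Proof.
rewrite /undef => ab; split=> E; move: ab; rewrite E.
  by have [_ ->] := pmul1 b.
by have [->] := pmul1 a.
Qed.

(** * Length-preserving steps *)

Notation pg_step := (length_preserving (cyc_dagger (@pg_rule P))).

(** In a geodesic word neighbours have no product, so the side condition of the
    swap rule holds, and the new letters are nontrivial. *)
Lemma swap_pg_step (r q : seq (letter P)) (a b : letter P) c x y :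
  geod (vals (r ++ [:: a, b & q])) ->
  pmul (lval a) c = Some x -> pmul (pinv c) (lval b) = Some y ->
  exists k l : letter P, [/\ lval k = x, lval l = y &
    pg_step (r ++ [:: a, b & q]) (r ++ [:: k, l & q])].
Proof.
move=> gw ac cb; have ab : undef (lval a) (lval b).
  move: (geod_reduced gw); rewrite map_cat reduced_cat_cons => /andP[_].
  by case/andP.
have xy : undef x y by rewrite /undef (pmul_swap ac cb).
have [x1 y1] := undef_neq1 xy.
exists (exist _ x x1), (exist _ y y1); split=> //; split; last by rewrite !size_cat.
left; exists (r ++ [:: a, b & q]), (r ++ [:: exist _ x x1, exist _ y y1 & q]).
split; try exact: cyc_eq_refl.
exists r, q, [:: a; b], [:: exist _ x x1; exist _ y y1]; split=> //.
by apply: (@pg_swap P _ _ _ _ c) => //; apply: undefE.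
Qed.

Lemma geod_pg_step (u v : seq (letter P)) :
  geod (vals u) -> size u = size v -> geq (vals u) (vals v) -> geod (vals v).
Proof.
move=> gu uv E; apply: (geod_conj (p := [::]) gu); first by rewrite conj0.
by rewrite !size_map.
Qed.

Lemma sweep_pg_steps u v : sweep u v ->
  forall r s t : seq (letter P), vals s = u -> vals t = v -> geod (vals (r ++ s)) ->
  cyc_steps pg_step (size u).-1 (r ++ s) (r ++ t).
Proof.
elim=> [a|a b c x y {}u {}v ac cb _ IH] r s t.
  case: s => [|k [|]] //= [ka]; case: t => [|l [|]] //= [la] _.
  by rewrite (lval_inj (etrans ka (esym la))); apply: cyc_eq_refl.
case: s => [|k [|l s]] //= [ka lb su]; case: t => [|n t] //= [nx tv] gw; subst.
have [n' [m [n'x my st]]] := swap_pg_step gw ac cb.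
rewrite (lval_inj n'x) in st; exists (r ++ [:: n, m & s]) => //.
rewrite -cat_rcons -(cat_rcons n r t); apply: IH => //=; first by rewrite my.
rewrite cat_rcons; apply: geod_pg_step gw _ _; first by rewrite !size_cat.
rewrite !map_cat /=; apply: geq_cat => //.
by rewrite my -(geq_mul _ cb) (geq_mul _ (pmulKr ac)).
Qed.

Lemma cyc_eq_vals (s : seq (letter P)) u :
  cyc_eq (vals s) u -> exists2 t, u = vals t & cyc_eq s t.
Proof.
case/cyc_eq_rot=> n ->; exists (rot n s); first by rewrite map_rot.
by apply/cyc_eq_rot; exists n.
Qed.

(** On the cyclic word, conjugation by c is the swap along c of the last and the
    first letter; the sweep accounts for the remaining [(size g).-1] steps. *)
Lemma one_conj_pg_steps (g f : seq (letter P)) :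
  geod (vals g) -> geod (vals f) -> size f = size g ->
  one_conj (vals g) (vals f) -> cyc_steps pg_step (size g) g f.
Proof.
move=> gg gf fg [c [a [m [b [x [z [gab ca bc xz]]]]]]].
have [t tE gt] := cyc_eq_vals gab.
case: t tE gt => [//|k t] [ak]; case/lastP: t => [|t l]; first by case: (m).
rewrite map_rcons => /rcons_inj[mt bl] gt; subst.
have gl : cyc_eq g [:: l, k & t].
  apply: cyc_eq_trans gt _; apply: cyc_eq_sym.
  exact: (cyc_eq_rcons l (k :: t)).
have gg' : geod (vals [:: l, k & t]).
  apply: geod_cyc gg; case: gl => r [s [-> ->]].
  by exists (vals r), (vals s); rewrite !map_cat.
have [z' [x' [zE xE st]]] := @swap_pg_step [::] t l k c z x gg' bc ca.
have hE : x :: rcons (vals t) z = vals (x' :: rcons t z') by rewrite /= map_rcons xE zE.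
have -> : size g = (size (vals (x' :: rcons t z'))).-1.+1.
  by rewrite (cyc_eq_size gl) size_map /= size_rcons.
have xf : pg_step g (x' :: rcons t z').
  case: st => st sz; split; last by rewrite (cyc_eq_size gl) /= size_rcons.
  apply: cyc_dagger_compat st; first exact: cyc_eq_sym.
  exact: (cyc_eq_rcons z' (x' :: t)).
exists (x' :: rcons t z') => //.
have fs : size f = (size t).+2 by rewrite fg (cyc_eq_size gl).
have gh : geod (vals (x' :: rcons t z')).
  apply: (geod_conj (p := [::]) gf); first by rewrite conj0 -hE; apply: geq_sym.
  by rewrite !size_map fs /= size_rcons.
apply: (@sweep_pg_steps _ (vals f) _ [::]) => //.
move: gf xz fs; rewrite hE; case: (f) => // b0 f0 gf xz _.
by apply: geq_reduced_sweep => //; apply: geod_reduced.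
Qed.

(** * Preconjugation of letters *)

(** P embeds in U(P). *)
Lemma geq_letter a b : geq [:: a] [:: b] -> a = b.
Proof.
move=> ab; have : sweep [:: a] [:: b] by apply: geq_reduced_sweep ab.
by move=> S; inversion S.
Qed.

Lemma geq_pmul3 c a b d : pmul3 c a b d -> geq [:: c; a; b] [:: d].
Proof.
case=> [[x ca xb]|[y ab cy]]; first by rewrite (geq_mul _ ca) (geq_mul _ xb).
by rewrite (geq_cons c (geq_mul [::] ab)) (geq_mul _ cy).
Qed.

Lemma pmul3_letter c (a : letter P) d :
  pmul3 c (lval a) (pinv c) d -> exists2 b : letter P, lval b = d & preconj a b.
Proof.
move=> cd; have [d1|d1] := classic (d = pone); last first.
  by exists (exist _ d d1) => //; exists c.
have := geq_conjV (p := [:: pinv c]) (w := [:: lval a]) (v := [:: d]).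
rewrite /conj /inv /= !pinvK => /(_ (geq_pmul3 cd)).
rewrite d1 geq_one (geq_mul [::] (proj1 (pmulV c))).
by move/geq_letter/esym => a1; case: (proj2_sig a).
Qed.

(** Let c be the first letter of the conjugating word c p and suppose that c^-1 a c
    is not in P.  If x = c^-1 a is defined, then the equality with b forces the
    next letter d of p to meet x; as a commutes with itself, c p may be replaced
    by a^-1 c p, and this is shorter because a^-1 c d = x^-1 d is in P.  The case
    where ac is defined is symmetric, with a c p as the new conjugating word. *)
Lemma preconj_seq_conj n p (a b : letter P) : size p < n ->
  geq (conj p [:: lval a]) [:: lval b] -> preconj_seq a b.
Proof.
elim: n p a => [//|n IH] p a; rewrite ltnS => pn ab.
have next c d q : size q < n -> geq p (pinv c :: q) ->
    pmul3 c (lval a) (pinv c) d -> preconj_seq a b.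
  move=> qn pq cd; have [a' ad aa'] := pmul3_letter cd.
  apply: rt_trans (rt_step _ _ _ _ aa') _; apply: (IH q) => //.
  rewrite -ab pq -(cat1s (pinv c)) conj_cat ad; apply: geq_conj_proper => //.
  by rewrite -(geq_pmul3 cd) /conj /inv /= pinvK.
have [rp|[q pq]] := contr_or_reduced p; last first.
  apply: (IH q); first by rewrite -(contr_size pq).
  by rewrite -ab -(ceq_geq (rst_step _ _ _ _ pq)).
case: p pn rp ab next => [|c p] pn rp ab next.
  move: ab; rewrite conj0 => /geq_letter/lval_inj->; exact: rt_refl.
have aVa : geq (conj [:: pinv (lval a)] [:: lval a]) [:: lval a].
  rewrite /conj /inv /= pinvK (geq_cons _ (geq_mul [::] (proj2 (pmulV _)))).
  by rewrite (geq_mul [::] (proj1 (pmul1 _))).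
have aa : geq (conj [:: lval a] [:: lval a]) [:: lval a].
  by rewrite /conj /inv /= (geq_mul _ (proj1 (pmulV _))) geq_one.
have met w : 1 < size w -> reduced w -> geq (conj [:: c] [:: lval a]) w ->
    meets p w || meets p (inv w).
  move=> w1 rw cw; apply: (@conj_meets _ _ [:: lval b]) (path_sorted rp) rw _.
  - by rewrite /= addnAC (leq_trans w1) ?leq_addl.
  - exact: ltnW.
  - by rewrite -cw -conj_cat.
case ca: (pmul (pinv c) (lval a)) => [x|].
  have ac : pmul (pinv (lval a)) c = Some (pinv x).
    by have := pmul_inv ca; rewrite pinvK.
  case xc: (pmul x c) => [z|].
    by apply: (next (pinv c) z p) => //; rewrite pinvK //; left; exists x.
  have /orP[] : meets p [:: x; c] || meets p (inv [:: x; c]).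
  - apply: met => //; first by rewrite /reduced /= undefI.
    by rewrite /conj /inv /= (geq_mul _ ca).
  - case: p pn rp ab {next met} => //= d q pn rp ab; case dx: pmul => [s|//] _.
    apply: (IH (pinv s :: q)) => //.
    have xd : pmul (pinv x) d = Some (pinv s).
      by have := pmul_inv dx; rewrite pinvK.
    by rewrite -ab -(geq_mul _ xd) -(geq_mul _ ac) -cat1s conj_cat aVa.
  - rewrite /inv /=; case: (p) rp => //= d q.
    by rewrite pmul_invE /undef => /andP[/negPf->].
case ac: (pmul (lval a) c) => [x|].
  case cx: (pmul (pinv c) x) => [z|].
    by apply: (next (pinv c) z p) => //; rewrite pinvK //; right; exists x.
  have /orP[] : meets p [:: pinv c; x] || meets p (inv [:: pinv c; x]).
  - apply: met => //; first by rewrite /reduced /= undefI.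
    by rewrite /conj /inv /= (geq_cons _ (geq_mul _ ac)).
  - case: (p) rp => //= d q.
    by rewrite pmul_invE /undef => /andP[/negPf->].
  - case: p pn rp ab {next met} => //= d q pn rp ab; rewrite pmul_invE.
    case xd: pmul => [s|//] _; apply: (IH (s :: q)) => //.
    by rewrite -ab -(geq_mul _ xd) -(geq_mul _ ac) -(cat1s (lval a)) conj_cat aa.
have := @conj_meets (c :: p) [:: lval a] [:: lval b].
by rewrite /= ca pmul_invE ac !addn1 => /(_ isT isT rp isT ab).
Qed.

End Pregroup.

Theorem corollary4p5 (P : pregroup) :
  (forall w : seq (letter P), cyclically_reduced w ->
     forall v : seq (letter P), univ_conj w v -> size w <= size v) /\
  (forall g f : seq (letter P),
     cyclically_reduced g -> cyclically_reduced f -> univ_conj g f ->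
     [/\ size g = size f,
         2 <= size g ->
           exists2 n, n <= size g &
             cyc_steps (length_preserving (cyc_dagger (@pg_rule P))) n g f
       & size g = 1 ->
           exists a b : letter P,
             [/\ g = [:: a], f = [:: b] & preconj_seq a b]]).
Proof.
split=> // g f gg gf gfc; have [p pgf] := univ_conj_conj gfc.
have gg' := cyclically_reduced_geod gg; have gf' := cyclically_reduced_geod gf.
have sgf : size g = size f.
  apply/eqP; rewrite eqn_leq gg //=.
  by have := gf' _ _ (geq_conjV pgf); rewrite !size_map.
split=> // [g2|].
  exists (size g) => //; apply: one_conj_pg_steps => //.
  by apply: (conj_uptoP (ltnSn (size p))) pgf; rewrite ?size_map.
move: sgf pgf {gg gf gfc gg' gf'}.
case: g => [//|a [|//]]; case: f => [//|b [|//]] _ pab _; exists a, b; split=> //.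
exact: preconj_seq_conj (ltnSn _) pab.
Qed.
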